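(* Let $K$ be a field, $S=K[x_1,\ldots,x_n]$, and let $I$ be a monomial ideal of $S$. Let $b\geq 1$ and $a\geq b-1$ be integers such that $a+b\leq \mathrm{proj\,dim}(S/I)$. Then $$t_{a+b}\leq t_a+t_1+t_2+\cdots+t_b-\frac{b(b-1)}{2},$$ where $t_i=t_i(S/I)$ denotes the maximal shift in homological degree $i$ of the minimal graded free $S$-resolution of $S/I$.
   Context: $S=K[x_1,\ldots,x_n]$ is graded with $\deg(x_i)=1$ for all $i$. For a graded ideal $I\subset S$, the graded Betti numbers are $\beta_{i,j}(S/I)=\dim_K \mathrm{Tor}_i^S(S/I,K)_j$; equivalently, the $i$-th module in the minimal graded free $S$-resolution of $S/I$ is $F_i=\bigoplus_j S(-j)^{\beta_{i,j}(S/I)}$. For $0\leq i\leq \mathrm{proj\,dim}(S/I)$ (projective dimension over $S$), $t_i=t_i(S/I):=\max\{j : \beta_{i,j}(S/I)\neq 0\}$. *)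

(* Defs.v *)
From HB Require Import structures.
From mathcomp Require Import all_boot all_order all_algebra.
From mathcomp.multinomials Require Import mpoly.

Set Implicit Arguments.
Unset Strict Implicit.
Unset Printing Implicit Defensive.

Import GRing.Theory.

Local Open Scope ring_scope.
Local Open Scope quotient_scope.

(* MathComp quotients a ring only by a proper ideal; here is the quotient of  *)
(* any module by any submodule, on top of the additive quotient.              *)
Section LmodQuotient.
Variables (R : nzRingType) (V : lmodType R) (W : submodClosed V).

Definition submod_zmod : {pred V} := fun v => v \in W.

Lemma submod_zmod_closed : zmod_closed submod_zmod.
Proof.
split=> [|u v uW vW]; first exact: (rpred0 W).
by apply: (rpredD (S := W)) => //; rewrite -scaleN1r; apply: rpredZ.
Qed.

HB.instance Definition _ :=
  GRing.isZmodClosed.Build V submod_zmod submod_zmod_closed.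

Definition lquot : Type := Quotient.quot submod_zmod.

HB.instance Definition _ := GRing.Zmodule.on lquot.

Definition lquot_pi (v : V) : lquot := \pi_(Quotient.quot submod_zmod) v.

Definition lquot_scale (c : R) (y : lquot) : lquot :=
  lquot_pi (c *: repr (y : Quotient.quot submod_zmod)).

Lemma lquot_piP (u v : V) : lquot_pi u = lquot_pi v <-> u - v \in W.
Proof.
rewrite -[_ \in W]/(u - v \in submod_zmod) Quotient.idealrBE.
by split=> /eqP.
Qed.

Lemma lquot_pi_surj (y : lquot) : exists v, lquot_pi v = y.
Proof. by exists (repr (y : Quotient.quot submod_zmod)); apply: reprK. Qed.

Lemma lquot_piD (u v : V) : lquot_pi (u + v) = lquot_pi u + lquot_pi v.
Proof. exact: (raddfD (\pi_(Quotient.quot submod_zmod))). Qed.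

Lemma lquot_piZ (c : R) (v : V) : lquot_pi (c *: v) = lquot_scale c (lquot_pi v).
Proof.
apply/lquot_piP; rewrite -scalerBr; apply: rpredZ; apply/lquot_piP.
by apply/esym/reprK.
Qed.

Lemma lquot_scaleA (c d : R) (y : lquot) :
  lquot_scale c (lquot_scale d y) = lquot_scale (c * d) y.
Proof.
by case: (lquot_pi_surj y) => v <-; rewrite -!lquot_piZ scalerA.
Qed.

Lemma lquot_scale1 : left_id 1 lquot_scale.
Proof.
by move=> y; case: (lquot_pi_surj y) => v <-; rewrite -!lquot_piZ scale1r.
Qed.

Lemma lquot_scaleDr : right_distributive lquot_scale +%R.
Proof.
move=> c x y; case: (lquot_pi_surj x) => u <-; case: (lquot_pi_surj y) => v <-.
by rewrite -lquot_piD -!lquot_piZ scalerDr lquot_piD.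
Qed.

Lemma lquot_scaleDl (y : lquot) : {morph lquot_scale^~ y : c d / c + d}.
Proof.
move=> c d; case: (lquot_pi_surj y) => v <-.
by rewrite -!lquot_piZ scalerDl lquot_piD.
Qed.

HB.instance Definition _ := GRing.Zmodule_isLmodule.Build R lquot
  lquot_scaleA lquot_scale1 lquot_scaleDr lquot_scaleDl.

Lemma lquot_pi_is_linear : linear lquot_pi.
Proof. by move=> c u v; rewrite lquot_piD lquot_piZ. Qed.

HB.instance Definition _ :=
  GRing.isLinear.Build R V lquot *:%R lquot_pi lquot_pi_is_linear.

End LmodQuotient.

Section ProjectiveDimension.
Variables (R : nzRingType) (M : lmodType R).

Definition is_resolution (P : nat -> lmodType R)
    (d : forall i, {linear P i.+1 -> P i}) (eps : {linear P 0%N -> M}) : Prop :=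
  [/\ forall y, exists x, eps x = y,
      forall x, eps x = 0 <-> exists y, d 0%N y = x
    & forall i x, d i x = 0 <-> exists y, d i.+1 y = x].

Definition projective (P : lmodType R) : Prop :=
  forall (A B : lmodType R) (g : {linear A -> B}) (f : {linear P -> B}),
    (forall y, exists x, g x = y) ->
    exists h : {linear P -> A}, forall x, g (h x) = f x.

Definition projdim_le (m : nat) : Prop :=
  exists (P : nat -> lmodType R) (d : forall i, {linear P i.+1 -> P i})
         (eps : {linear P 0%N -> M}),
    [/\ is_resolution d eps,
        forall i, projective (P i)
      & forall i, (m < i)%N -> forall x : P i, x = 0].

(* Also meaningful when the projective dimension is infinite.                 *)
Definition le_projdim (m : nat) : Prop := forall d, projdim_le d -> (m <= d)%N.

End ProjectiveDimension.

Section MonomialIdeals.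
Variables (K : fieldType) (n : nat).
Local Notation S := {mpoly K[n]}.

(* An ideal of S is a submodule of the regular module S^o; the whole ring and *)
(* the zero ideal are allowed.                                                *)
Definition monomial_ideal (I : submodClosed S^o) : Prop :=
  exists G : 'X_{1..n} -> Prop, forall f : S,
    f \in I <-> exists (r : nat) (c : 'I_r -> S) (m : 'I_r -> 'X_{1..n}),
      (forall k, G (m k)) /\ f = \sum_(k < r) c k * 'X_[m k].

(* x is homogeneous of degree e in the direct sum of the S(-s k).             *)
Definition free_homog r (s : 'I_r -> nat) (e : nat) (x : 'rV[S]_r) : Prop :=
  forall k (m : 'X_{1..n}), m \in msupp (x 0 k) -> (mdeg m + s k = e)%N.

Definition quot_homog (I : submodClosed S^o) (e : nat) (y : lquot I) : Prop :=
  exists2 f : S, f \is e.-homog & lquot_pi I f = y.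

(* The generators of F_i sit in degrees [mgr_shift i k].  Natural numbers     *)
(* suffice, because S/I, and hence each F_i, lives in degrees >= 0.           *)
Record min_graded_resolution (I : submodClosed S^o) := MinGradedResolution {
  mgr_rank : nat -> nat;
  mgr_shift : forall i, 'I_(mgr_rank i) -> nat;
  mgr_diff : forall i, {linear 'rV[S]_(mgr_rank i.+1) -> 'rV[S]_(mgr_rank i)};
  mgr_aug : {linear 'rV[S]_(mgr_rank 0%N) -> lquot I};
  mgr_exact :
    is_resolution (P := fun i => 'rV[S]_(mgr_rank i)) mgr_diff mgr_aug;
  mgr_aug_homog : forall e x,
    free_homog (@mgr_shift 0%N) e x -> quot_homog e (mgr_aug x);
  mgr_diff_homog : forall i e x,
    free_homog (@mgr_shift i.+1) e x -> free_homog (@mgr_shift i) e (mgr_diff i x);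
  (* the image of F_(i+1) lies in (x_1, ..., x_n) F_i *)
  mgr_minimal : forall i x k, (mgr_diff i x 0 k)@_0%MM = 0
}.

Variables (I : submodClosed S^o) (F : min_graded_resolution I).

Definition betti (i j : nat) : nat :=
  #|[set k : 'I_(mgr_rank F i) | mgr_shift k == j]|.

(* Junk value 0 when F_i = 0; see [max_shiftP].                               *)
Definition max_shift (i : nat) : nat :=
  \max_(k < mgr_rank F i) mgr_shift k.

Lemma betti_neq0P i j :
  reflect (exists k : 'I_(mgr_rank F i), mgr_shift k = j) (betti i j != 0%N).
Proof.
rewrite /betti -lt0n; apply: (iffP card_gt0P) => -[k].
  by rewrite inE => /eqP <-; exists k.
by move=> <-; exists k; rewrite inE.
Qed.

Lemma max_shiftP i : (0 < mgr_rank F i)%N ->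
  betti i (max_shift i) != 0%N /\
  forall j, betti i j != 0%N -> (j <= max_shift i)%N.
Proof.
move=> r_gt0; split; last first.
  by move=> j /betti_neq0P[k <-]; apply: (leq_bigmax k).
apply/betti_neq0P; have [|k Ek] := eq_bigmax (@mgr_shift _ F i).
  by rewrite card_ord.
by exists k; apply/esym.
Qed.

End MonomialIdeals.

(* Main.v *)
Require Import Defs.
From HB Require Import structures.
From mathcomp Require Import all_boot all_order all_algebra.
From mathcomp.multinomials Require Import mpoly.
From Stdlib Require Import Classical ClassicalEpsilon.

(* Tor_i(S/I, K) is read off the Taylor complex on ordered tuples of          *)
(* generators: in multidegree a it is the homology of the chains on           *)
(* {s | lcm s divides a} modulo those on {s | lcm s <> a}.  A minimal graded  *)
(* resolution F is homotopy equivalent to this complex, so the degrees |a|    *)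
(* with Tor_i nonzero at a are exactly the shifts of F_i.                     *)
(* Let Tor_(c+1) be nonzero at a, and let f be a generator dividing a.  The   *)
(* simplex on the generators dividing a is acyclic and coning off f kills the *)
(* tuples s with lcm(f, s) <> a, hence Tor_c is nonzero at some d <> a with   *)
(* lcm(f, d) = a, and |a| <= |d| + |f|.  In particular multidegrees strictly  *)
(* decrease along homological degrees: for i <= c there is b dividing a with  *)
(* Tor_(i+1) nonzero at b, and below b a generator f with |f| + i <= |b|.     *)
(* Therefore t_(c+1) + i <= t_c + t_(i+1), and the theorem follows by summing *)
(* over (c, i) = (a, b - 1), (a + 1, b - 2), ..., (a + b - 1, 0).             *)

(** A Tor class in multidegree a forces, for every generator f dividing a, a class one homological
    degree lower in some multidegree d with lcm(f, d) = a ([lcm_acyclicS]). The choice of f is free,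
    and the gain comes from choosing f small: descending from a to a multidegree b of Tor_(i+1), and
    from there to Tor_1, costs at least one degree per homological step and ends at a generator of
    degree at most |b| - i ([lcm_cyclic_le], [lcm_cyclic_step]). Hence t_(c+1) <= t_c + t_(i+1) - i
    whenever i <= c ([max_shift_step]). The condition a >= b - 1 makes every instance used in
    [max_shift_sum] legitimate, and the savings 0, ..., b - 1 add up to b(b - 1)/2. The
    combinatorial Tor is tied to the shifts of an arbitrary minimal graded resolution by
    [shift_cyclic] and [cyclic_shift], which compare it with the Taylor resolution modulo (x_1, ...,
    x_n). *)

Set Implicit Arguments.
Unset Strict Implicit.
Unset Printing Implicit Defensive.

Import GRing.Theory.
Local Open Scope ring_scope.

(** * Ordered chains *)

Section OrderedChains.
Variables (G : finType) (V : zmodType).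
Implicit Types (z y : seq G -> V) (s : seq G).

(* bdry z s is the alternating sum of z over the insertions of one letter in s. *)
Fixpoint bdry z s : V :=
  \sum_g z (g :: s) - (if s is a :: s' then bdry (fun r => z (a :: r)) s' else 0).

(** The join of f with z: chains are coefficient functions, so [f :: s] receives the coefficient of
    [s]. *)
Definition cone (f : G) z s : V :=
  if s is g :: s' then (if g == f then z s' else 0) else 0.

(** This locality is what later allows a chain to be cut down to the tuples of a single lcm. *)
Lemma eq_bdry_in z y s :
  (forall r, size r = (size s).+1 -> {subset s <= r} -> z r = y r) ->
  bdry z s = bdry y s.
Proof.
elim: s z y => [|a s IH] z y Ezy /=.
  by congr (_ - _); apply: eq_bigr => g _; apply: Ezy.
congr (_ - _).
  by apply: eq_bigr => g _; apply: Ezy => // x sx; rewrite inE sx orbT.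
apply: IH => r rs sr; apply: Ezy => /=; first by rewrite rs.
by move=> x; rewrite !inE => /orP[->//|/sr->]; rewrite orbT.
Qed.

Lemma eq_bdry z y : z =1 y -> bdry z =1 bdry y.
Proof. by move=> Ezy s; apply: eq_bdry_in. Qed.

Lemma bdry0 s : bdry (fun=> 0) s = 0.
Proof. by elim: s => [|a s IH] /=; rewrite ?IH big1 ?subr0. Qed.

Lemma bdry_supp z s :
  (forall r, size r = (size s).+1 -> {subset s <= r} -> z r = 0) -> bdry z s = 0.
Proof. by move=> z0; rewrite (eq_bdry_in (y := fun=> 0)) ?bdry0. Qed.

Lemma bdryD z y s : bdry (fun r => z r + y r) s = bdry z s + bdry y s.
Proof.
elim: s z y => [|a s IH] z y /=; first by rewrite !subr0 big_split.
by rewrite IH big_split /= opprD addrACA.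
Qed.

Lemma bdryN z s : bdry (fun r => - z r) s = - bdry z s.
Proof.
apply/eqP; rewrite -subr_eq0 opprK -bdryD.
by rewrite (eq_bdry (y := fun=> 0)) ?bdry0 // => r; rewrite addNr.
Qed.

Lemma bdryB z y s : bdry (fun r => z r - y r) s = bdry z s - bdry y s.
Proof. by rewrite bdryD bdryN. Qed.

Lemma bdry_sum (J : Type) (js : seq J) (P : pred J) (zz : J -> seq G -> V) s :
  bdry (fun r => \sum_(j <- js | P j) zz j r) s = \sum_(j <- js | P j) bdry (zz j) s.
Proof.
elim: js => [|j js IH].
  by rewrite big_nil (eq_bdry (y := fun=> 0)) ?bdry0 // => r; rewrite big_nil.
rewrite big_cons -IH; case: ifP => Pj; last first.
  by apply: eq_bdry => r; rewrite big_cons Pj.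
by rewrite -bdryD; apply: eq_bdry => r; rewrite big_cons Pj.
Qed.

(** [P] inserts a letter in front. By [bE], [P] after [bdry] plus [bdry] after [P] is [P] applied
    twice, so expanding both boundaries leaves only a term on the tail, settled by induction. *)
Lemma bdry_bdry z s : bdry (bdry z) s = 0.
Proof.
pose P z' r : V := \sum_g z' (g :: r).
have bE z' r : P (bdry z') r = P (P z') r - bdry (P z') r.
  by rewrite (bdry_sum _ _ (fun g => z' \o cons g)) -sumrB.
elim: s z => [|a s IH] z.
  by rewrite /= subr0 -/(P (bdry z) [::]) bE /= subr0 subrr.
have Econs r : bdry z (a :: r) = P z (a :: r) - bdry (z \o cons a) r by [].
rewrite [LHS]/= -/(P (bdry z) (a :: s)) bE (eq_bdry Econs) bdryB IH subr0 /=.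
by rewrite -/(P (P z) (a :: s)) opprB addrCA subrr addr0 subrr.
Qed.

(** Coning is a contracting homotopy of the full simplex, augmented by the empty tuple: every cycle
    bounds its own cone. *)
Lemma bdry_cone f z s : bdry (cone f z) s = z s - cone f (bdry z) s.
Proof.
have Esum : \sum_g cone f z (g :: s) = z s.
  by rewrite (bigD1 f) //= eqxx big1 ?addr0 // => g /negPf->.
case: s Esum => [|a s] /= Esum; rewrite Esum //; congr (_ - _).
by case: eqP => // _; rewrite bdry0.
Qed.

End OrderedChains.

(** * Divisibility of monomials and total degree *)

Section MonomialOrder.
Variable n : nat.
Implicit Types m : 'X_{1..n}.

Lemma lepm_mdeg m1 m2 : (m1 <= m2)%MM -> (mdeg m1 <= mdeg m2)%N.
Proof. by move=> le12; rewrite -(submK le12) mdegD leq_addl. Qed.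

Lemma lepm_eq_mdeg m1 m2 : (m1 <= m2)%MM -> (mdeg m2 <= mdeg m1)%N -> m1 = m2.
Proof.
move=> le12; rewrite -[in mdeg m2](submK le12) mdegD -[leqRHS]add0n leq_add2r.
by rewrite leqn0 mdeg_eq0 => /eqP d0; rewrite -(submK le12) d0 add0m.
Qed.

Lemma lepm_anti m1 m2 : (m1 <= m2)%MM -> (m2 <= m1)%MM -> m1 = m2.
Proof. by move=> le12 /lepm_mdeg; apply: lepm_eq_mdeg. Qed.

End MonomialOrder.

(** * Multigraded Tor of a monomial ideal *)

Section LcmHomology.
Variables (n : nat) (G : finType) (gen : G -> 'X_{1..n}) (V : zmodType).
Implicit Types (x y z w : seq G -> V) (s r : seq G) (a b m : 'X_{1..n}).

Definition slcm s : 'X_{1..n} := foldr (fun g m => mlcm (gen g) m) 0%MM s.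

Lemma slcm_le m s : (slcm s <= m)%MM = all (fun g => (gen g <= m)%MM) s.
Proof.
elim: s => [|g s IH] /=; first by apply/mnm_lepP => i; rewrite mnmE.
by rewrite lem_mlcm IH.
Qed.

Lemma slcm_subset s r : {subset s <= r} -> (slcm s <= slcm r)%MM.
Proof.
move=> sr; rewrite slcm_le; apply/allP => g /sr gr.
by have := lepm_refl (slcm r); rewrite slcm_le => /allP/(_ g gr).
Qed.

Lemma slcm_gen g : slcm [:: g] = gen g.
Proof. by rewrite /= mlcm0. Qed.

(* Vanishing of H_i of (chains on {lcm | a}) modulo (chains on {lcm | a and   *)
(* lcm <> a}), that is, of Tor_i(S/I, K) in multidegree a.                    *)
Definition lcm_acyclic i a : Prop := forall z,
  (forall s, z s != 0 -> size s = i /\ slcm s = a) ->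
  (forall s, slcm s = a -> bdry z s = 0) ->
  exists w, (forall s, w s != 0 -> size s = i.+1 /\ slcm s = a) /\
            forall s, slcm s = a -> bdry w s = z s.

Definition restr (Q : pred 'X_{1..n}) z s := if Q (slcm s) then z s else 0.

Lemma bdry_neq0 z s :
  bdry z s != 0 -> exists r, [/\ z r != 0, size r = (size s).+1 & {subset s <= r}].
Proof.
move=> bz; apply: NNPP => nex; case/eqP: bz; apply: bdry_supp => r rs sr.
by apply/eqP/negP => /negP zr; apply: nex; exists r.
Qed.

(* The part of y in Q is removed one degree at a time, from the top: in the   *)
(* highest remaining degree it is a relative cycle in each multidegree.       *)
Lemma lcm_filtration i (P Q : pred 'X_{1..n}) D y :
  (forall a b, (a <= b)%MM -> P b -> P a) ->
  (forall a, Q a -> P a) ->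
  (forall a b, (a <= b)%MM -> Q a -> P b -> Q b) ->
  (forall a, P a -> mdeg a < D)%N ->
  (forall a, Q a -> lcm_acyclic i a) ->
  (forall s, y s != 0 -> size s = i /\ P (slcm s)) ->
  (forall s, Q (slcm s) -> bdry y s = 0) ->
  exists x, (forall s, x s != 0 -> size s = i.+1 /\ Q (slcm s)) /\
            forall s, Q (slcm s) -> bdry x s = y s.
Proof.
move=> Pdown QP Qup PD acyc.
have : forall s, Q (slcm s) -> (D <= mdeg (slcm s))%N -> y s = 0.
  by move=> s /QP/PD; rewrite ltnNge => /negPf->.
elim: D {PD} y => [|D IH] y y0 ysupp ycyc.
  exists (fun=> 0); split=> [s|s Qs]; first by rewrite eqxx.
  by rewrite bdry0 y0.
have wex a : exists w, Q a -> mdeg a = D ->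
    (forall s, w s != 0 -> size s = i.+1 /\ slcm s = a) /\
    forall s, slcm s = a -> bdry w s = y s.
  case Qa: (Q a); last by exists (fun=> 0).
  case: (mdeg a =P D) => [aD|]; last by exists (fun=> 0).
  have [||w [ws bw]] := acyc a Qa (restr (pred1 a) y).
  - move=> s; rewrite /restr /=; case: (slcm s =P a) => [sa /ysupp[-> _]|]; by rewrite ?eqxx.
  - move=> s sa; rewrite -[RHS](ycyc s) ?sa //; apply: eq_bdry_in => r rs sr.
    rewrite /restr /=; case: eqP => // ra; apply/esym/eqP/negP => /negP yr.
    have sLr := slcm_subset sr; rewrite sa in sLr.
    have Qr : Q (slcm r) by apply: Qup sLr Qa _; case: (ysupp _ yr).
    case/eqP: yr; apply: y0 => //; rewrite ltnNge -aD.
    by apply/negP => /(lepm_eq_mdeg sLr)/esym.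
  exists w => _ _; split=> // s sa; rewrite bw // /restr /= sa eqxx //.
pose W a := proj1_sig (constructive_indefinite_description _ (wex a)).
have WP a : Q a -> mdeg a = D ->
    (forall s, W a s != 0 -> size s = i.+1 /\ slcm s = a) /\
    forall s, slcm s = a -> bdry (W a) s = y s.
  exact: (proj2_sig (constructive_indefinite_description _ (wex a))).
pose w s := if Q (slcm s) && (mdeg (slcm s) == D) then W (slcm s) s else 0.
have wsupp s : w s != 0 -> [/\ size s = i.+1, Q (slcm s) & mdeg (slcm s) = D].
  rewrite /w; case: ifP => [/andP[Qs /eqP sD]|]; last by rewrite eqxx.
  by case: (WP _ Qs sD) => Ws _ /Ws[].
have [|||x [xsupp bx]] := IH (fun s => y s - bdry w s).
- move=> s Qs; rewrite leq_eqVlt => /orP[/eqP sD|Ds].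
    case: (WP _ Qs (esym sD)) => WLs bW; rewrite -(bW s erefl).
    apply/eqP; rewrite subr_eq0; apply/eqP/eq_bdry_in => r rs sr.
    have sLr := slcm_subset sr; rewrite /w; case: ifP => [/andP[_ /eqP rD]|].
      by rewrite (lepm_eq_mdeg sLr) // rD -sD.
    have [->//|/WLs[_ ->]] := eqVneq (W (slcm s) r) 0.
    by rewrite Qs -sD eqxx.
  rewrite y0 ?(ltnW Ds) // sub0r; apply/eqP; rewrite oppr_eq0.
  apply/negP => /negP/bdry_neq0[r [/wsupp[_ _ rD] _ /slcm_subset/lepm_mdeg]].
  by rewrite rD leqNgt Ds.
- move=> s; have [->|/ysupp//] := eqVneq (y s) 0.
  rewrite sub0r oppr_eq0 => /bdry_neq0[r [/wsupp[ri /QP Pr _]]].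
  rewrite ri => -[->] /slcm_subset sr; split=> //; exact: Pdown sr Pr.
- by move=> s Qs; rewrite bdryB bdry_bdry ycyc ?subrr.
exists (fun s => x s + w s); split=> [s|s Qs]; last by rewrite bdryD bx // subrK.
by have [->|/xsupp//] := eqVneq (x s) 0; rewrite add0r => /wsupp[].
Qed.

(** The boundary of a relative cycle z lies strictly below a. Its part where the lcm with f is a can
    be removed by [lcm_filtration]; the rest bounds its cone from f, which stays strictly below a.
    Thus z is corrected strictly below a to an absolute cycle, and that bounds its cone from f. *)
Lemma lcm_acyclicS c a (f : G) : (gen f <= a)%MM ->
  (forall b, mlcm (gen f) b = a -> b <> a -> lcm_acyclic c b) ->
  lcm_acyclic c.+1 a.
Proof.
move=> fa acyc z zsupp zcyc.
pose P := [pred b | (b <= a)%MM && (b != a)].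
pose Q := [pred b | P b && (mlcm (gen f) b == a)].
have bsupp x : (forall s, x s != 0 -> size s = c.+1 /\ (slcm s <= a)%MM) ->
    forall s, bdry x s != 0 -> size s = c /\ (slcm s <= a)%MM.
  move=> xs s /bdry_neq0[r [/xs[rc ra] rs /slcm_subset sr]].
  by split; [move: rs; rewrite rc => -[] | apply: lepm_trans sr ra].
have ysupp s : bdry z s != 0 -> size s = c /\ P (slcm s).
  move=> yn0; have [|-> /= ->] := bsupp z _ s yn0.
    by move=> r /zsupp[-> ->]; rewrite lepm_refl.
  by split=> //; apply/negP => /eqP/zcyc/eqP; apply/negP.
have [|||||||x1 [x1s bx1]] := @lcm_filtration c P Q (mdeg a) (bdry z).
- move=> b d bd /andP[da dna]; rewrite /= (lepm_trans bd da).
  by apply: contraNneq dna => ba; apply/eqP/lepm_anti; rewrite // -ba.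
- by move=> b /andP[].
- move=> b d bd /andP[_ /eqP fb] Pd; apply/andP; split=> //.
  apply/eqP/lepm_anti; first by rewrite lem_mlcm fa; case/andP: Pd.
  by rewrite -fb !lem_mlcm lem_mlcml (lepm_trans bd) // lem_mlcmr.
- move=> b /andP[ba bna]; rewrite ltnNge; apply: contra bna => /(lepm_eq_mdeg ba).
  by move->.
- by move=> b /andP[/andP[_ /eqP bna] /eqP fb]; apply: acyc.
- exact: ysupp.
- by move=> s _; apply: bdry_bdry.
(* What is left of the boundary avoids [Q], so putting [f] in front of its tuples does not produce
   the lcm [a]. *)
pose y2 s := bdry z s - bdry x1 s.
have by2 s : bdry y2 s = 0 by rewrite bdryB !bdry_bdry subrr.
have x1a s : x1 s != 0 -> size s = c.+1 /\ (slcm s <= a)%MM.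
  by move=> /x1s[-> /andP[/andP[->]]].
have y2supp s : y2 s != 0 -> size s = c /\ (slcm (f :: s) <= a)%MM /\ slcm (f :: s) <> a.
  rewrite /y2 => yn0.
  have [si sP] : size s = c /\ (slcm s <= a)%MM.
    have [z0|/ysupp[-> /andP[]//]] := eqVneq (bdry z s) 0.
    by move: yn0; rewrite z0 sub0r oppr_eq0 => /(bsupp x1 x1a).
  split=> //; split; first by rewrite /= lem_mlcm fa sP.
  move=> fsa; case/negP: yn0; rewrite subr_eq0; apply/eqP.
  have [sa|sna] := eqVneq (slcm s) a; last first.
    by rewrite bx1 // /Q /= sP sna; apply/eqP.
  rewrite zcyc //; apply/esym/bdry_supp => r _ /slcm_subset; rewrite sa => ar.
  apply/eqP/negP => /negP/x1s[_ /andP[/andP[ra /eqP rna]] _].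
  by apply: rna; apply: lepm_anti.
pose x2 := cone f y2.
have bx2 s : bdry x2 s = y2 s.
  rewrite bdry_cone (_ : cone f _ s = 0) ?subr0 //; case: s => //= g s.
  by rewrite by2 if_same.
have x2s s : x2 s != 0 -> [/\ size s = c.+1, (slcm s <= a)%MM & slcm s <> a].
  case: s => [|g s]; rewrite /x2 /cone ?eqxx //.
  by case: (g =P f) => [->/y2supp[<- []]|]; rewrite ?eqxx.
pose x s := x1 s + x2 s.
have xs s : x s != 0 -> [/\ size s = c.+1, (slcm s <= a)%MM & slcm s <> a].
  rewrite /x; have [->|/x1s[-> /andP[/andP[-> /eqP]]]//] := eqVneq (x1 s) 0.
  by rewrite add0r => /x2s.
(* [t] agrees with [z] on the tuples of lcm [a] and is an absolute cycle. *)
pose t s := z s - x s.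
have bt s : bdry t s = 0.
  by rewrite bdryB /x bdryD bx2 /y2 [bdry x1 s + _]addrC subrK subrr.
have ts s : t s != 0 -> size s = c.+1 /\ (slcm s <= a)%MM.
  rewrite /t; have [->|/zsupp[-> ->]] := eqVneq (z s) 0; last by rewrite lepm_refl.
  by rewrite sub0r oppr_eq0 => /xs[].
pose w := cone f t.
have bw s : bdry w s = t s.
  rewrite bdry_cone (_ : cone f _ s = 0) ?subr0 //; case: s => //= g s.
  by rewrite bt if_same.
have ws s : w s != 0 -> size s = c.+2 /\ (slcm s <= a)%MM.
  case: s => [|g s]; rewrite /w /cone ?eqxx //.
  case: (g =P f) => [->/ts[<- sa]|]; rewrite ?eqxx //=.
  by rewrite lem_mlcm fa.
exists (restr (pred1 a) w); split=> [s|s sa].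
  by rewrite /restr /=; case: (slcm s =P a) => [sa /ws[]|]; rewrite ?eqxx.
have -> : z s = bdry w s.
  rewrite bw /t; have [->|/xs[_ _]//] := eqVneq (x s) 0; by rewrite subr0.
apply: eq_bdry_in => r _ /slcm_subset; rewrite sa /restr /= => ar.
case: eqP => // rna; apply/esym/eqP/negP => /negP/ws[_ ra].
by apply: rna; apply: lepm_anti.
Qed.

Lemma lcm_cyclic_nil i a : ~ lcm_acyclic i.+1 a -> exists f, (gen f <= a)%MM.
Proof.
move=> ncyc; apply: NNPP => nf; apply: ncyc => z zs _.
exists (fun=> 0); split=> [s|s _]; first by rewrite eqxx.
rewrite bdry0; apply/esym/eqP/negP => /negP/zs.
case: s => [[]//|f s] [_ fs]; apply: nf; exists f.
by rewrite -fs /= lem_mlcml.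
Qed.

(** Each use of [lcm_acyclicS] lowers the homological degree by one and passes to a proper divisor,
    which costs at least one in total degree. *)
Lemma lcm_cyclic_le i k a : ~ lcm_acyclic (i + k) a ->
  exists b, [/\ (b <= a)%MM, ~ lcm_acyclic i b & (mdeg b + k <= mdeg a)%N].
Proof.
elim: k a => [|k IH] a; first by rewrite !addn0 => na; exists a; rewrite lepm_refl addn0.
rewrite addnS => na; have [f fa] := lcm_cyclic_nil na.
have [b [ba bna nb]] : exists b, [/\ (b <= a)%MM, b <> a & ~ lcm_acyclic (i + k) b].
  apply: NNPP => nex; apply: na; apply: (lcm_acyclicS fa) => b fb bna.
  apply: NNPP => nb; apply: nex; exists b; split=> //.
  by rewrite -fb lem_mlcmr.
have [d [db nd ltd]] := IH b nb; exists d; split=> //.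
  exact: lepm_trans db ba.
rewrite addnS; apply: leq_ltn_trans ltd _; rewrite ltnNge.
by apply/negP => /(lepm_eq_mdeg ba).
Qed.

Lemma lcm_cyclic1 a : ~ lcm_acyclic 1 a -> exists f, gen f = a.
Proof.
move=> na; apply: NNPP => nf; apply: na => z zs _.
exists (fun=> 0); split=> [s|s _]; first by rewrite eqxx.
rewrite bdry0; apply/esym/eqP/negP => /negP/zs.
by case: s => [[]//|f [[_ fs]|h s []//]]; apply: nf; exists f; rewrite -slcm_gen.
Qed.

(* Here b is a multidegree below a supporting Tor_(i+1), f is a generator of  *)
(* degree at most |b| - i dividing b, and a = lcm(f, d).                      *)
Lemma lcm_cyclic_step c i a : (i <= c)%N -> ~ lcm_acyclic c.+1 a ->
  exists b d, [/\ ~ lcm_acyclic i.+1 b, ~ lcm_acyclic c d &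
                  (mdeg a + i <= mdeg d + mdeg b)%N].
Proof.
move=> ic na.
have [b [ba nb _]] : exists b, [/\ (b <= a)%MM, ~ lcm_acyclic i.+1 b &
    (mdeg b + (c - i) <= mdeg a)%N].
  by apply: lcm_cyclic_le; rewrite addSn subnKC.
have [b1 [b1b nb1 deg1]] : exists b1, [/\ (b1 <= b)%MM, ~ lcm_acyclic 1 b1 &
    (mdeg b1 + i <= mdeg b)%N].
  by apply: lcm_cyclic_le; rewrite add1n.
have [f fb1] := lcm_cyclic1 nb1.
have [d [fd nd]] : exists d, mlcm (gen f) d = a /\ ~ lcm_acyclic c d.
  apply: NNPP => nex; apply: na; apply: (@lcm_acyclicS _ _ f).
    by rewrite fb1 (lepm_trans b1b ba).
  by move=> d fd _; apply: NNPP => nd; apply: nex; exists d.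
(* The degree of lcm(f, d) is |d| plus the degree of the part of f missing from d, which is at most
   |f|. *)
exists b, d; split=> //; rewrite -fd mlcmC mlcmE mdegD -addnA leq_add2l.
by apply: leq_trans deg1; rewrite leq_add2r -fb1 mdegB.
Qed.

End LcmHomology.

Lemma mcoeff_mulX (n : nat) (K : nzRingType) (p : {mpoly K[n]}) (d e : 'X_{1..n}) :
  (p * 'X_[d])@_e = if (d <= e)%MM then p@_(e - d) else 0.
Proof.
case: ifP => [de|nde]; first by rewrite -[in LHS](submK de) addmC mcoeffMX.
apply/eqP; rewrite mcoeff_eq0 (perm_mem (msuppMX _ _)).
by apply/mapP => -[m _ em]; rewrite em lem_addr in nde.
Qed.

Lemma bdryZ (G : finType) (R : nzRingType) (c : R) (z : seq G -> R) s :
  bdry (fun r => c * z r) s = c * bdry z s.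
Proof.
elim: s z => [|a s IH] z /=; first by rewrite !subr0 mulr_sumr.
by rewrite IH mulrBr mulr_sumr.
Qed.

(** * The Taylor complex on tuples of generators *)

Section TaylorComplex.
Variables (n : nat) (K : fieldType) (G : finType) (gen : G -> 'X_{1..n}).
Local Notation S := {mpoly K[n]}.
Local Notation lcms := (slcm gen).
Local Notation N i := #|{: i.-tuple G}|.
Local Notation T i := 'rV[S]_(N i).
Implicit Types (s r : seq G) (m : 'X_{1..n}).

Definition face i (k : 'I_(N i)) : seq G := (enum_val k : i.-tuple G).

(* T i is the free module on the i-tuples of generators, s in multidegree     *)
(* lcm(s); tcoef u m s is the coefficient at s of the part of u of            *)
(* multidegree m, so that each u amounts to a family of K-valued chains.      *)
Definition tcoef i (u : T i) m s : K :=
  if (lcms s <= m)%MM then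
    if insub s is Some t then (u 0 (enum_rank t))@_(m - lcms s) else 0
  else 0.

Lemma face_inj i : injective (@face i).
Proof. by move=> k l /val_inj/enum_val_inj. Qed.

(** The signed incidence number of [s] in [r], read off the boundary of an indicator chain so that
    signs and repeated letters agree with [bdry]. *)
Definition tdiff_coeff (r s : seq G) : K := bdry (fun x => (x == r)%:R) s.

Definition tdiff_mx i : 'M[S]_(N i.+1, N i) :=
  \matrix_(k, l) (tdiff_coeff (face k) (face l) *:
                  'X_[lcms (face k) - lcms (face l)]).

Definition tdiff i : {linear T i.+1 -> T i} := mulmxr (tdiff_mx i).

Lemma tcoef0 i m s : tcoef (0 : T i) m s = 0.
Proof.
by rewrite /tcoef; case: ifP => // _; case: insub => // t; rewrite mxE mcoeff0.
Qed.

Lemma tcoef_supp i (u : T i) m s :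
  tcoef u m s != 0 -> size s = i /\ (lcms s <= m)%MM.
Proof.
rewrite /tcoef; case: ifP => [_|]; last by rewrite eqxx.
by case: insubP => [t /eqP szs _ _|]; rewrite ?eqxx.
Qed.

Lemma tcoefE i (u : T i) m k : (lcms (face k) <= m)%MM ->
  tcoef u m (face k) = (u 0 k)@_(m - lcms (face k)).
Proof. by rewrite /tcoef => ->; rewrite /face valK enum_valK. Qed.

(** Reduction modulo (x_1, ..., x_n) thus keeps, in multidegree m, only the tuples of lcm m: these
    are the relative chains of [lcm_acyclic]. *)
Lemma tcoef_const i (u : T i) k :
  tcoef u (lcms (face k)) (face k) = (u 0 k)@_0%MM.
Proof. by rewrite tcoefE ?lepm_refl // -[X in (X - _)%MM]add0m addmK. Qed.

Lemma seq_enum_val i s : size s = i -> exists k : 'I_(N i), s = face k.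
Proof.
by move=> /eqP si; exists (enum_rank (Tuple si)); rewrite /face enum_rankK.
Qed.

Lemma eq_tcoef i (u v : T i) : (forall m s, tcoef u m s = tcoef v m s) -> u = v.
Proof.
move=> Euv; apply/rowP => k; apply/mpolyP => m.
have := Euv (m + lcms (face k))%MM (face k).
by rewrite !tcoefE ?lem_addl // addmK.
Qed.

Lemma tdiff_coeff_neq0 r s : tdiff_coeff r s != 0 ->
  size r = (size s).+1 /\ (lcms s <= lcms r)%MM.
Proof.
move=> /bdry_neq0[x [xr szx sx]]; have exr : x = r.
  by apply/eqP; apply: contraNT xr => /negPf->.
by rewrite -exr; split=> //; apply: slcm_subset.
Qed.

Lemma bdry_expand i (z : seq G -> K) s : (forall r, z r != 0 -> size r = i) ->
  bdry z s = \sum_(k < N i) z (face k) * tdiff_coeff (face k) s.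
Proof.
move=> zi; rewrite (@eq_bdry _ _ _
    (fun r => \sum_(k < N i) z (face k) * (r == face k)%:R)).
  by rewrite bdry_sum; apply: eq_bigr => k _; rewrite bdryZ.
move=> r; have [szr|szr] := eqVneq (size r) i.
  have [k ->] := seq_enum_val szr; rewrite (bigD1 k) //= eqxx mulr1.
  rewrite big1 ?addr0 // => l lk; case: eqP => [/face_inj kl|_].
    by rewrite kl eqxx in lk.
  by rewrite mulr0.
rewrite big1 => [|k _].
  by apply/eqP; apply: contraNT szr => /zi ->.
case: eqP => [rk|_]; last by rewrite mulr0.
by move: szr; rewrite rk size_tuple eqxx.
Qed.

(** The monomials in [tdiff_mx] only restore the multidegree, so in each fixed multidegree the
    Taylor differential is the ordered boundary over K. *)
Lemma tcoef_tdiff i (u : T i.+1) m s : tcoef (tdiff i u) m s = bdry (tcoef u m) s.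
Proof.
have [/seq_enum_val[l ->]|szs] := eqVneq (size s) i; last first.
  rewrite bdry_supp => [|r rs _].
    by apply/eqP; apply: contraNT szs => /tcoef_supp[->].
  by apply/eqP; apply: contraNT szs => /tcoef_supp[]; rewrite rs => -[->].
rewrite (@bdry_expand i.+1) => [|r /tcoef_supp[]//].
have [lm|nlm] := boolP (lcms (face l) <= m)%MM; last first.
  rewrite /tcoef (negPf nlm) big1 // => k _; case: ifP => km; last by rewrite mul0r.
  have [->|/tdiff_coeff_neq0[_ lk]] := eqVneq (tdiff_coeff (face k) (face l)) 0.
    by rewrite mulr0.
  by rewrite (lepm_trans lk km) in nlm.
rewrite tcoefE // mxE raddf_sum; apply: eq_bigr => k _ /=.
rewrite mxE -scalerAr mcoeffZ mcoeff_mulX mulrC.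
have [->|/tdiff_coeff_neq0[_ lk]] := eqVneq (tdiff_coeff (face k) (face l)) 0.
  by rewrite !mulr0.
congr (_ * _); rewrite /tcoef /face valK enum_valK.
have -> : (lcms (face k) - lcms (face l) <= m - lcms (face l))%MM =
    (lcms (face k) <= m)%MM.
  apply/mnm_lepP/mnm_lepP => + j => /(_ j); move: lk lm => /mnm_lepP/(_ j) + /mnm_lepP/(_ j).
    by rewrite !mnmBE => lk lm; rewrite leq_sub2rE.
  by rewrite !mnmBE => lk lm; rewrite leq_sub2rE.
by case: ifP => // _; rewrite submDA addmC submK.
Qed.

Lemma tcoef_bound i (u : T i) : exists B, forall m s, tcoef u m s != 0 -> (mdeg m < B)%N.
Proof.
exists (\max_(k < N i) (msize (u 0%R k) + mdeg (lcms (face k)))).+1 => m s us.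
have [/seq_enum_val[k sk] sm] := tcoef_supp us.
rewrite ltnS; apply: leq_trans (leq_bigmax k).
move: us; rewrite sk tcoefE -?sk // sk -mcoeff_msupp => /msize_mdeg_lt um.
rewrite sk in sm; rewrite -(submK sm) mdegD leq_add2r; exact: ltnW.
Qed.

(** Turns chains chosen multidegree by multidegree into one element of the Taylor complex; [B] keeps
    its entries polynomial. *)
Lemma tcoef_build i (v : 'X_{1..n} -> seq G -> K) B :
  (forall m s, v m s != 0 -> [/\ size s = i, (lcms s <= m)%MM & (mdeg m < B)%N]) ->
  exists u : T i, forall m s, tcoef u m s = v m s.
Proof.
move=> vsupp.
exists (\row_k \sum_(m : 'X_{1..n < B}) v (m + lcms (face k))%MM (face k) *: 'X_[m]).
move=> m s; have [/seq_enum_val[k ->]|szs] := eqVneq (size s) i; last first.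
  have -> : v m s = 0 by apply/eqP; apply: contraNT szs => /vsupp[->].
  by apply/eqP; apply: contraNT szs => /tcoef_supp[->].
have [km|km] := boolP (lcms (face k) <= m)%MM; last first.
  have -> : v m (face k) = 0 by apply/eqP; apply: contraNT km => /vsupp[].
  by apply/eqP; apply: contraNT km => /tcoef_supp[].
rewrite tcoefE // mxE; have [mB|Bm] := ltnP (mdeg (m - lcms (face k))) B.
  rewrite (mcoeff_mpoly (fun m' => v (m' + lcms (face k))%MM (face k))) //.
  by rewrite submK.
have -> : v m (face k) = 0.
  apply/eqP; apply: contraLR Bm => /vsupp[_ _ mB]; rewrite -ltnNge.
  exact: leq_ltn_trans (mdegB _ _) mB.
rewrite raddf_sum big1 // => m' _; rewrite /= mcoeffZ mcoeffX.
case: eqP => [mm'|_]; last by rewrite mulr0.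
by move: Bm; rewrite -mm' leqNgt bmdeg.
Qed.

End TaylorComplex.

(** * Comparison of resolutions *)

Section RowCombination.
Variables (R : nzRingType) (A : lmodType R) (r : nat).

Definition rowcomb (a : 'I_r -> A) (x : 'rV[R]_r) : A := \sum_k x 0 k *: a k.

Lemma rowcomb_is_linear a : linear (rowcomb a).
Proof.
move=> c x y; rewrite /rowcomb scaler_sumr -big_split; apply: eq_bigr => k _ /=.
by rewrite !mxE scalerDl scalerA.
Qed.

HB.instance Definition _ a :=
  GRing.isLinear.Build R 'rV[R]_r A *:%R (rowcomb a) (rowcomb_is_linear a).

Lemma rowcombE (h : {linear 'rV[R]_r -> A}) x :
  h x = rowcomb (fun k => h (delta_mx 0 k)) x.
Proof. by rewrite {1}[x]row_sum_delta linear_sum; under eq_bigr do rewrite linearZ. Qed.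

Lemma rowcomb_delta a k : rowcomb a (delta_mx 0 k) = a k.
Proof.
rewrite /rowcomb (bigD1 k) //= big1 => [|l lk].
  by rewrite mxE !eqxx scale1r addr0.
by rewrite mxE (negPf lk) andbF scale0r.
Qed.

End RowCombination.

Lemma rowcomb_lift (R : nzRingType) (r : nat) (A B : lmodType R)
    (g : {linear A -> B}) (f : {linear 'rV[R]_r -> B})
    (H : 'I_r -> A -> Prop) :
  (forall k, exists2 y, H k y & g y = f (delta_mx 0 k)) ->
  exists2 h : {linear 'rV[R]_r -> A},
    forall k, H k (h (delta_mx 0 k)) & forall x, g (h x) = f x.
Proof.
move=> lifts; have [a Ha ga] : exists2 a, forall k, H k (a k) &
    forall k, g (a k) = f (delta_mx 0 k).
  have [k|a Ha] := @fin_all_exists 'I_r (fun=> A)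
    (fun k y => H k y /\ g y = f (delta_mx 0 k)); last by exists a => k; case: (Ha k).
  by case: (lifts k) => y; exists y.
exists (rowcomb a) => [k|x]; first by rewrite /= rowcomb_delta.
rewrite linear_sum [RHS]rowcombE; apply: eq_bigr => k _.
by rewrite linearZ /= ga.
Qed.

Lemma dependent_choice (X : nat -> Type) (P : forall i, X i -> Prop)
    (E : forall i, X i -> X i.+1 -> Prop) :
  (exists x, P 0%N x) ->
  (forall i x, P i x -> exists y, P i.+1 y /\ E i x y) ->
  exists f : forall i, X i, forall i, P i (f i) /\ E i (f i) (f i.+1).
Proof.
move=> /constructive_indefinite_description x0 step.
pose next i (u : {x | P i x}) : {y | P i.+1 y /\ E i (proj1_sig u) y} :=
  constructive_indefinite_description _ (step i _ (proj2_sig u)).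
pose fix f i : {x | P i x} :=
  if i is j.+1 then
    exist _ (proj1_sig (next j (f j))) (proj1 (proj2_sig (next j (f j))))
  else x0.
exists (fun i => proj1_sig (f i)) => i; split; first exact: proj2_sig.
exact: (proj2 (proj2_sig (next i (f i)))).
Qed.

(** The augmentation serves as the differential out of degree 0, so that one induction covers all
    degrees. *)
Definition is_cycle (R : nzRingType) (Q : nat -> lmodType R) (M : lmodType R)
    (d : forall i, {linear Q i.+1 -> Q i}) (eps : {linear Q 0%N -> M}) i : Q i -> Prop :=
  match i return Q i -> Prop with
  | 0%N => fun y => eps y = 0
  | j.+1 => fun y => d j y = 0
  end.

Lemma is_cycleP (R : nzRingType) (Q : nat -> lmodType R) (M : lmodType R)
    (d : forall i, {linear Q i.+1 -> Q i}) (eps : {linear Q 0%N -> M}) :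
  is_resolution d eps ->
  forall i (y : Q i), is_cycle d eps y <-> exists w, d i w = y.
Proof. by case=> _ ex0 exS [|i] y; [apply: ex0 | apply: exS]. Qed.

Section Comparison.
Variables (R : nzRingType) (M : lmodType R).
Variables (r : nat -> nat) (Q : nat -> lmodType R).
Local Notation P i := 'rV[R]_(r i).
Variables (dP : forall i, {linear P i.+1 -> P i}) (epsP : {linear P 0%N -> M}).
Variables (dQ : forall i, {linear Q i.+1 -> Q i}) (epsQ : {linear Q 0%N -> M}).
Hypotheses (epsP_d : forall x, epsP (dP 0 x) = 0)
           (dP_d : forall i x, dP i (dP i.+1 x) = 0).

(* hP and hQ stand for homogeneity; taken trivial, they give ungraded maps.   *)
Lemma comparison_map (s : forall i, 'I_(r i) -> nat)
    (hP : forall i, nat -> P i -> Prop) (hQ : forall i, nat -> Q i -> Prop) :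
  (forall i k, hP i (s i.+1 k) (dP i (delta_mx 0 k))) ->
  (forall i e (a : 'I_(r i) -> Q i) x,
     hP i e x -> (forall k, hQ i (s i k) (a k)) -> hQ i e (rowcomb a x)) ->
  (forall k, exists2 y, hQ 0%N (s 0%N k) y & epsQ y = epsP (delta_mx 0 k)) ->
  (forall i e (y : Q i), hQ i e y -> is_cycle dQ epsQ y ->
     exists2 w, hQ i.+1 e w & dQ i w = y) ->
  exists f : forall i, {linear P i -> Q i},
    [/\ forall x, epsQ (f 0%N x) = epsP x,
        forall i x, dQ i (f i.+1 x) = f i (dP i x)
      & forall i k, hQ i (s i k) (f i (delta_mx 0 k))].
Proof.
move=> dP_hom comb lift0 lift.
pose X i : Type := {linear P i -> Q i}.
(* The second condition is what lifting to the next degree needs; compatibility with the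
   augmentation concerns degree 0 only. *)
pose J i (f : X i) := [/\ forall k, hQ i (s i k) (f (delta_mx 0 k)),
  forall x, is_cycle dQ epsQ (f (dP i x)) &
  match i return X i -> Prop with
  | 0%N => fun f => forall x, epsQ (f x) = epsP x | _ => fun=> True end f].
pose E i (f : X i) (g : X i.+1) := forall x, dQ i (g x) = f (dP i x).
have [||f fP] := @dependent_choice X J E.
- have [f hf ef] := rowcomb_lift lift0.
  by exists f; split=> // x; rewrite /= ef epsP_d.
- move=> i f [hf cf _].
  have [k|g hg dg] := @rowcomb_lift _ _ _ _ (dQ i) (f \o dP i) (fun k => hQ i.+1 (s i.+1 k)).
    apply: lift; last exact: cf.
    by rewrite /= [f _]rowcombE; apply: comb.
  exists g; split=> //; split=> // x.
  by rewrite /= dg /= dP_d linear0.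
exists f; split=> [x|i x|i k]; last by case: (fP i) => -[].
  by case: (fP 0%N) => -[].
by case: (fP i).
Qed.

Lemma null_homotopy (f : forall i, {linear P i -> Q i}) :
  is_resolution dQ epsQ ->
  (forall x, epsQ (f 0%N x) = 0) -> (forall i x, dQ i (f i.+1 x) = f i (dP i x)) ->
  exists h : forall i, {linear P i -> Q i.+1},
    (forall x, f 0%N x = dQ 0%N (h 0%N x)) /\
    forall i x, f i.+1 x = dQ i.+1 (h i.+1 x) + h i (dP i x).
Proof.
move=> exQ f0 fd.
have lift i (g : {linear P i -> Q i}) : (forall x, is_cycle dQ epsQ (g x)) ->
    exists h : {linear P i -> Q i.+1}, forall x, dQ i (h x) = g x.
  move=> cg; have [k|h _ dh] := @rowcomb_lift _ _ _ _ (dQ i) g (fun _ _ => True).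
    by have /(is_cycleP exQ)[w] := cg (delta_mx 0 k); exists w.
  by exists h.
pose X i : Type := {linear P i -> Q i.+1}.
(* The first condition makes [f i.+1 \- (h \o dP i)] land in the cycles, hence liftable. *)
pose J i (h : X i) := (forall x, dQ i (h (dP i x)) = f i (dP i x)) /\
  match i return X i -> Prop with
  | 0%N => fun h => forall x, f 0%N x = dQ 0%N (h x) | _ => fun=> True end h.
pose E i (h : X i) (h' : X i.+1) := forall x, f i.+1 x = dQ i.+1 (h' x) + h (dP i x).
have [||h hP] := @dependent_choice X J E.
- by have [h dh] := lift 0%N (f 0%N) f0; exists h; split.
- move=> i h [ch _].
  have [|h' dh'] := lift i.+1 (f i.+1 \- (h \o dP i)).
    by move=> x; rewrite /= linearB /= fd ch subrr.
  have Eh' : E i h h' by move=> x; rewrite dh' /= subrK.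
  exists h'; split=> //; split=> // x.
  by rewrite [RHS]Eh' dP_d linear0 addr0.
by exists h; split=> [|i]; [case: (hP 0%N) => -[] | case: (hP i)].
Qed.

End Comparison.

Lemma rV_linear_const (n : nat) (K : fieldType) p q
    (h : {linear 'rV[{mpoly K[n]}]_p -> 'rV[{mpoly K[n]}]_q}) x l :
  (h x 0 l)@_0%MM = \sum_k (x 0 k)@_0%MM * (h (delta_mx 0 k) 0 l)@_0%MM.
Proof.
rewrite rowcombE summxE raddf_sum; apply: eq_bigr => k _.
by rewrite mxE /= rmorphM.
Qed.

(** * Tor and minimal graded resolutions *)

Section TaylorResolution.
Variables (K : fieldType) (n : nat) (G : finType) (gen : G -> 'X_{1..n}).
Local Notation S := {mpoly K[n]}.
Local Notation lcms := (slcm gen).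
Local Notation N i := #|{: i.-tuple G}|.
Local Notation T i := 'rV[S]_(N i).
Local Notation tcoef := (tcoef gen).
Variable I : submodClosed S^o.
Hypothesis IP : forall f : S,
  f \in I <-> forall m, m \in msupp f -> exists g, (gen g <= m)%MM.
Implicit Types (s r : seq G) (m : 'X_{1..n}).

Definition taug : {linear T 0%N -> lquot I} := rowcomb (fun=> lquot_pi I (1 : S^o)).

Local Notation tcycle :=
  (is_cycle (Q := fun i => 'rV[S]_(N i)) (tdiff K gen) taug).

Lemma taugE : exists k0 : 'I_(N 0%N), [/\ face k0 = [::], forall k, k = k0 &
  forall u, taug u = lquot_pi I (u 0 k0 : S^o)].
Proof.
have [k0 fk0] := @seq_enum_val G 0 [::] erefl.
have all0 (k : 'I_(N 0%N)) : k = k0.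
  by apply: face_inj; rewrite -fk0; apply: size0nil; rewrite size_tuple.
exists k0; split; [exact: esym | exact: all0 | move=> u].
rewrite /taug /= /rowcomb (bigD1 k0) //= big1 => [|k].
  by rewrite addr0 -[LHS]linearZ; congr lquot_pi; apply: mulr1.
by rewrite (all0 k) eqxx.
Qed.

Lemma lquot_pi_eq0 (f : S^o) : lquot_pi I f = 0 <-> f \in I.
Proof.
have <- : lquot_pi I 0 = 0 by rewrite linear0.
by rewrite lquot_piP subr0.
Qed.

Lemma taug_eq0 u :
  taug u = 0 <-> forall m s, tcoef u m s != 0 -> exists g, (gen g <= m)%MM.
Proof.
have [k0 [fk0 allk ->]] := taugE; rewrite lquot_pi_eq0 IP.
have cE m : tcoef u m [::] = (u 0 k0)@_m.
  have lem0 : (lcms (face k0) <= m)%MM by rewrite fk0 slcm_le.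
  rewrite -fk0 tcoefE // fk0 /=; congr (_@__).
  by rewrite -[LHS]addm0 submK //; rewrite fk0 in lem0.
split=> [uI m s us|uI m]; last by rewrite mcoeff_msupp -cE; apply: uI.
have [/size0nil s0 _] := tcoef_supp us.
by apply: uI; rewrite mcoeff_msupp -cE -s0.
Qed.

Lemma taylor_cycle i (u : T i) : tcycle u ->
  (forall m s, bdry (tcoef u m) s = 0) /\
  forall m s, tcoef u m s != 0 -> exists g, (gen g <= m)%MM.
Proof.
case: i u => [|i] u /=.
  move=> /taug_eq0 uI; split=> // m s; apply: bdry_supp => r rs _.
  by apply/eqP; apply/negP => /negP/tcoef_supp[]; rewrite rs.
move=> du; split=> m s; first by rewrite -tcoef_tdiff /= du tcoef0.
move=> /tcoef_supp[]; case: s => // g s _ /= gm; exists g.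
by apply: lepm_trans gm; apply: lem_mlcml.
Qed.

(** In multidegree m the cycle lives on the simplex of generators dividing m, nonempty wherever the
    cycle is nonzero, and coning off one of them fills it. The filling keeps the multidegree, whence
    the control of degrees. *)
Lemma taylor_lift i (u : T i) : tcycle u ->
  exists2 w, tdiff K gen i w = u &
    forall e, (forall m s, tcoef u m s != 0 -> mdeg m = e) ->
              forall m s, tcoef w m s != 0 -> mdeg m = e.
Proof.
move=> /taylor_cycle[cu uI]; have [B uB] := tcoef_bound gen u.
pose v m s := if [pick g | (gen g <= m)%MM] is Some g then cone g (tcoef u m) s else 0.
have vsupp m s : v m s != 0 -> exists g s',
    [/\ (gen g <= m)%MM, s = g :: s' & tcoef u m s' != 0].
  rewrite /v; case: pickP => [g gm|]; last by rewrite eqxx.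
  case: s => [|h s] /=; first by rewrite eqxx.
  by case: (h =P g) => [->|]; rewrite ?eqxx // => us; exists g, s.
have [|w wv] := @tcoef_build _ K _ gen i.+1 v B.
  move=> m s /vsupp[g [s' [gm -> us]]]; split; last exact: uB us.
    by have [<-] := tcoef_supp us.
  by rewrite /= lem_mlcm gm; case: (tcoef_supp us).
exists w; last by move=> e ue m s; rewrite wv => /vsupp[g [s' [_ _ /ue]]].
apply: (@eq_tcoef _ _ _ gen) => m s; rewrite tcoef_tdiff (eq_bdry (wv m)) /v.
case: pickP => [g gm|nog].
  rewrite bdry_cone (_ : cone _ _ _ = 0) ?subr0 //.
  by case: s => //= h s; rewrite cu if_same.
rewrite bdry0; apply/esym/eqP/negP => /negP/uI[g gm].
by have := nog g; rewrite gm.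
Qed.

Lemma tdiff_tdiff i w : tdiff K gen i (tdiff K gen i.+1 w) = 0.
Proof.
apply: (@eq_tcoef _ _ _ gen) => m s.
by rewrite tcoef0 tcoef_tdiff (eq_bdry (tcoef_tdiff gen w m)) bdry_bdry.
Qed.

Lemma taug_tdiff w : taug (tdiff K gen 0%N w) = 0.
Proof.
apply/taug_eq0 => m s; rewrite tcoef_tdiff => /bdry_neq0[r [wr szr _]].
have [_] := tcoef_supp wr; case: r szr {wr} => // g r _ /= gm; exists g.
by apply: lepm_trans gm; apply: lem_mlcml.
Qed.

Lemma taylor_resolution :
  is_resolution (P := fun i => 'rV[S]_(N i)) (tdiff K gen) taug.
Proof.
split=> [y|u|i u].
- have [f <-] := lquot_pi_surj y; have [k0 [_ _ augE]] := taugE.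
  by exists (const_mx (f : S)); rewrite augE mxE.
- split=> [u0|[w <-]]; last exact: taug_tdiff.
  by have [w] := @taylor_lift 0 u u0; exists w.
- split=> [u0|[w <-]]; last exact: tdiff_tdiff.
  by have [w] := @taylor_lift i.+1 u u0; exists w.
Qed.

Lemma tcoef_rowcomb i p (sh : 'I_p -> nat) (a : 'I_p -> T i) x e :
  free_homog sh e x ->
  (forall k m s, tcoef (a k) m s != 0 -> mdeg m = sh k) ->
  forall m s, tcoef (rowcomb a x) m s != 0 -> mdeg m = e.
Proof.
move=> xe ae m s cn0; have [/seq_enum_val[l sl] lm] := tcoef_supp cn0.
rewrite {}sl in cn0 lm; move: cn0; rewrite tcoefE // summxE raddf_sum => sn0.
have [k kn0] : exists k, (x 0 k * a k 0 l)@_(m - lcms (face l)) != 0.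
  apply: NNPP => nex; case/eqP: sn0; apply: big1 => k _; rewrite mxE.
  by apply/eqP/negP => /negP kn0; apply: nex; exists k.
move: kn0; rewrite -mcoeff_msupp => /msuppM_le/allpairsP[[m1 m2] /= [m1x m2a Em]].
rewrite -(submK lm) Em -addmA mdegD.
rewrite (ae k (m2 + lcms (face l))%MM (face l)).
  exact: xe m1x.
by rewrite tcoefE ?lem_addl // addmK -mcoeff_msupp.
Qed.

(** * Shifts of a minimal resolution versus multigraded Tor *)

Section Compare.
Variable F : min_graded_resolution I.
Local Notation r := (mgr_rank F).
Local Notation shift i := (@mgr_shift _ _ _ F i).

(* The homotopies enter only modulo (x_1, ..., x_n), where the terms through  *)
(* the differential of F vanish by minimality.                                *)
Lemma taylor_comparison :
  exists (phi : forall i, {linear 'rV[S]_(r i) -> T i})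
         (psi : forall i, {linear T i -> 'rV[S]_(r i)}),
  [/\ forall i k m s, tcoef (phi i (delta_mx 0 k)) m s != 0 -> mdeg m = shift i k,
      forall i x s, bdry (tcoef (phi i x) (lcms s)) s = 0,
      forall i w l, (psi i (tdiff K gen i w) 0 l)@_0%MM = 0,
      forall i x l, (psi i (phi i x) 0 l)@_0%MM = (x 0 l)@_0%MM
    & forall i (u : T i), (forall s, bdry (tcoef u (lcms s)) s = 0) ->
        exists w, forall k, (u 0 k)@_0%MM =
          (phi i (psi i u) 0 k)@_0%MM + (tdiff K gen i w 0 k)@_0%MM].
Proof.
have [augF_surj augF_d dF_d] := mgr_exact F.
have exT := taylor_resolution.
have augFd x : mgr_aug F (mgr_diff F 0%N x) = 0 by apply/augF_d; exists x.
have dFd i x : mgr_diff F i (mgr_diff F i.+1 x) = 0 by apply/dF_d; exists x.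
have delta_homog i (k : 'I_(r i)) : 
    free_homog (shift i) (shift i k) (delta_mx 0 k : 'rV[S]_(r i)).
  move=> l m; rewrite mxE eqxx /=.
  by case: eqP => [->|_]; rewrite ?msupp0 // msupp1 inE => /eqP->; rewrite mdeg0.
have [k|i e u ue cu|phi [phi0 phid phi_hom]] := @comparison_map _ _ r (fun i => 'rV[S]_(N i))
    (mgr_diff F) (mgr_aug F) (tdiff K gen) taug augFd dFd (fun i => shift i)
    (fun i => free_homog (shift i))
    (fun i e u => forall m s, tcoef u m s != 0 -> mdeg m = e)
    (fun i k => mgr_diff_homog (delta_homog i.+1 k))
    (fun i e a x => @tcoef_rowcomb i _ _ a x e).
- have [f fe fE] := mgr_aug_homog (delta_homog 0%N k).
  have [k0 [_ _ augE]] := taugE.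
  exists (const_mx (f : S)); last by rewrite augE mxE.
  move=> m s fn0; have [sz sm] := tcoef_supp fn0.
  move: fn0; have [l sl] := seq_enum_val sz; rewrite {1}sl tcoefE -?sl //.
  rewrite mxE -mcoeff_msupp => /(dhomog_mf fe) <- /=.
  by rewrite -{1}(submK sm) mdegD (size0nil sz) mdeg0 addn0.
- by have [w dw /(_ e ue)] := taylor_lift cu; exists w.
(* Only [phi] has to respect degrees; [psi] is taken with trivial homogeneity. *)
have [//|//|k|i e u _ cu|psi [psi0 psid _]] := @comparison_map _ _ (fun i => N i)
    (fun i => 'rV[S]_(r i)) (tdiff K gen) taug (mgr_diff F) (mgr_aug F)
    taug_tdiff tdiff_tdiff (fun _ _ => 0%N) (fun _ _ _ => True) (fun _ _ _ => True).
- by have [y] := augF_surj (taug (delta_mx 0 k)); exists y.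
- by have /(is_cycleP (mgr_exact F))[w] := cu; exists w.
have [|i x|hF [hF0 hFS]] := @null_homotopy _ _ r (fun i => 'rV[S]_(r i))
    (mgr_diff F) (mgr_diff F) (mgr_aug F) dFd
    (fun i => (psi i \o phi i) \- idfun) (mgr_exact F).
- by move=> x; rewrite /= linearB /= psi0 phi0 subrr.
- by rewrite /= linearB /= psid phid.
have [|i x|hT [hT0 hTS]] := @null_homotopy _ _ (fun i => N i) (fun i => 'rV[S]_(N i))
    (tdiff K gen) (tdiff K gen) taug tdiff_tdiff
    (fun i => (phi i \o psi i) \- idfun) exT.
- by move=> x; rewrite [LHS]linearB /= phi0 psi0 subrr.
- by rewrite [LHS]linearB; congr (_ - _); rewrite [LHS]phid /= -psid.
exists phi, psi; split=> [|i x s|i w l|i x l|i u cu].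
- exact: phi_hom.
- case: i x => [|i] x.
    apply: bdry_supp => t ts _; apply/eqP/negP => /negP/tcoef_supp[].
    by rewrite ts.
  rewrite -tcoef_tdiff phid; have [/seq_enum_val[l ->]|szs] := eqVneq (size s) i.
    by rewrite tcoef_const rV_linear_const big1 // => k _; rewrite mgr_minimal mul0r.
  by apply/eqP; apply: contraNT szs => /tcoef_supp[->].
- by rewrite -psid mgr_minimal.
- apply/eqP; rewrite -subr_eq0 -mcoeffB; apply/eqP.
  case: i x l => [|i] x l.
    by have := congr1 (fun y : 'rV[S]__ => (y 0 l)@_0%MM) (hF0 x); rewrite !mxE mgr_minimal.
  have := congr1 (fun y : 'rV[S]__ => (y 0 l)@_0%MM) (hFS i x).
  rewrite !mxE [RHS]mcoeffD mgr_minimal add0r => ->.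
  by rewrite rV_linear_const big1 // => k _; rewrite mgr_minimal mul0r.
(* Here phi psi - id = d hT + hT d, and the last term vanishes modulo (x_1, ..., x_n) because [u] is
   a cycle there. *)
- exists (- hT i u) => k.
  suff E : (phi i (psi i u) 0 k)@_0%MM - (u 0 k)@_0%MM =
           (tdiff K gen i (hT i u) 0 k)@_0%MM.
    by rewrite linearN mxE mcoeffN -E subKr.
  rewrite -mcoeffB; case: i u cu k => [|i] u cu k.
    by have := congr1 (fun y : 'rV[S]__ => (y 0 k)@_0%MM) (hT0 u); rewrite [in LHS]mxE mxE.
  have := congr1 (fun y : 'rV[S]__ => (y 0 k)@_0%MM) (hTS i u).
  rewrite [in LHS]mxE [in RHS]mxE [RHS]mcoeffD mxE => ->.
  rewrite [X in _ + X]rV_linear_const [X in _ + X]big1 ?addr0 // => l _.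
  by rewrite -(tcoef_const gen) tcoef_tdiff cu mul0r.
Qed.

(** Otherwise the image under [phi] of the k-th basis vector would be a boundary modulo (x_1, ...,
    x_n). As [psi] kills boundaries there and psi phi is the identity there, 1 would be 0. *)
Lemma shift_cyclic i (k : 'I_(r i)) :
  exists2 a, mdeg a = shift i k & ~ lcm_acyclic gen K i a.
Proof.
apply: NNPP => nex.
have acyc a : mdeg a = shift i k -> lcm_acyclic gen K i a.
  by move=> ak; apply: NNPP => na; apply: nex; exists a.
have [phi [psi [phi_hom phi_cyc psi_bdry psi_phi _]]] := taylor_comparison.
pose u := phi i (delta_mx 0 k).
have wex a : exists w : seq G -> K, mdeg a = shift i k ->
    (forall s, w s != 0 -> size s = i.+1 /\ lcms s = a) /\
    forall s, lcms s = a -> bdry w s = tcoef u a s.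
  have [ak|] := eqVneq (mdeg a) (shift i k); last by move/eqP=> nak; exists (fun=> 0).
  have [||w [ws bw]] := acyc a ak (restr gen (pred1 a) (tcoef u a)).
  - move=> s; rewrite /restr /=; case: (lcms s =P a) => [sa /tcoef_supp[-> _]|]; by rewrite ?eqxx.
  - move=> s sa; rewrite -[RHS](phi_cyc i (delta_mx 0 k) s) sa.
    apply: eq_bdry_in => t _ /(slcm_subset gen); rewrite sa /restr /= => lat.
    case: eqP => // nta; apply/esym/eqP/negP => /negP/tcoef_supp[_ lta].
    by apply: nta; apply: lepm_anti.
  by exists w => _; split=> // s sa; rewrite bw // /restr /= sa eqxx.
pose W a := proj1_sig (constructive_indefinite_description _ (wex a)).
have WP a : mdeg a = shift i k ->
    (forall s, W a s != 0 -> size s = i.+1 /\ lcms s = a) /\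
    forall s, lcms s = a -> bdry (W a) s = tcoef u a s.
  exact: (proj2_sig (constructive_indefinite_description _ (wex a))).
(* F is graded by total degree only, so [u] may involve several multidegrees; their fillings are
   glued into one element. *)
pose v m s := if mdeg m == shift i k then W m s else 0.
have [|w wv] := @tcoef_build _ _ _ gen i.+1 v (shift i k).+1.
  move=> m s; rewrite /v; case: (mdeg m =P _) => [mk|_]; last by rewrite eqxx.
  by move=> /(proj1 (WP m mk))[-> ->]; rewrite lepm_refl mk.
have uw l : (u 0 l)@_0%MM = (tdiff K gen i w 0 l)@_0%MM.
  rewrite -!(tcoef_const gen) tcoef_tdiff (eq_bdry (wv _)) /v.
  case: (_ =P shift i k) => [lk|nlk]; first by case: (WP _ lk) => _ ->.
  rewrite bdry0; apply/eqP/negP => /negP/phi_hom; exact: nlk.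
have := psi_phi i (delta_mx 0 k) k; rewrite -/u mxE !eqxx /= mcoeff1 eqxx.
rewrite rV_linear_const; under eq_bigr do rewrite uw.
rewrite -rV_linear_const psi_bdry => /esym/eqP; by rewrite oner_eq0.
Qed.

(** A relative cycle at a equals phi psi of itself plus a boundary, modulo (x_1, ..., x_n). Without
    a generator of F_i in degree |a|, [phi] contributes nothing at a, and the cycle would bound. *)
Lemma cyclic_shift i a : ~ lcm_acyclic gen K i a -> exists k, shift i k = mdeg a.
Proof.
move=> na; apply: NNPP => nk; apply: na => z zs zcyc.
have [phi [psi [phi_hom _ _ _ phi_psi]]] := taylor_comparison.
(* [z] becomes an element with constant entries, concentrated in multidegree [a]. *)
pose v m s := if lcms s == m then z s else 0.
have [|u uv] := @tcoef_build _ _ _ gen i v (mdeg a).+1.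
  move=> m s; rewrite /v; case: (lcms s =P m) => [<- /zs[-> ->]|_]; last by rewrite eqxx.
  by rewrite lepm_refl.
have [|w uw] := phi_psi i u.
  move=> s; rewrite (eq_bdry (uv _)); have [sa|nsa] := eqVneq (lcms s) a.
    rewrite -[RHS](zcyc s sa); apply: eq_bdry_in => t _ _; rewrite /v.
    case: eqP => // nts; apply/esym/eqP/negP => /negP/zs[_ ta].
    by apply: nts; rewrite ta.
  apply: bdry_supp => t _ _; rewrite /v; case: eqP => // ts.
  by apply/eqP; apply: contraNT nsa => /zs[_ <-]; rewrite ts.
exists (restr gen (pred1 a) (tcoef w a)); split=> [s|s sa].
  rewrite /restr /=; case: (lcms s =P a) => [sa /tcoef_supp[-> _]|]; by rewrite ?eqxx.
have [szs|szs] := eqVneq (size s) i; last first.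
  have -> : z s = 0 by apply/eqP; apply: contraNT szs => /zs[->].
  apply: bdry_supp => t ts _; rewrite /restr; case: ifP => // _.
  by apply/eqP; apply: contraNT szs => /tcoef_supp[]; rewrite ts => -[->].
have -> : bdry (restr gen (pred1 a) (tcoef w a)) s = bdry (tcoef w a) s.
  apply: eq_bdry_in => t _ /(slcm_subset gen); rewrite sa /restr /= => lat.
  case: eqP => // nta; apply/esym/eqP/negP => /negP/tcoef_supp[_ lta].
  by apply: nta; apply: lepm_anti.
have [k sk] := seq_enum_val szs; have := uw k.
rewrite -!(tcoef_const gen) -sk sa tcoef_tdiff uv /v sa eqxx => ->.
have ak : a = lcms (face k) by rewrite -sk.
suff -> : tcoef (phi i (psi i u)) a s = 0 by rewrite add0r.
rewrite sk ak tcoef_const rV_linear_const big1 // => l _.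
rewrite -(tcoef_const gen) -ak; apply/eqP; rewrite mulf_eq0; apply/orP; right.
by apply/negP => /negP/phi_hom al; apply: nk; exists l.
Qed.

End Compare.
End TaylorResolution.

Lemma msuppM_lepm (n : nat) (K : nzRingType) (p q : {mpoly K[n]}) m :
  m \in msupp (p * q) -> exists2 m', m' \in msupp q & (m' <= m)%MM.
Proof.
by move=> /msuppM_le/allpairsP[[m1 m2] /= [_ m2q ->]]; exists m2; rewrite ?lem_addl.
Qed.

(** * Maximal shifts *)

Section MonomialIdealGenerators.
Variables (K : fieldType) (n : nat) (I : submodClosed {mpoly K[n]}^o).
Local Notation S := {mpoly K[n]}.

Lemma ideal_mulr (p f : S) : f \in I -> p * f \in I.
Proof. exact: (@rpredZ _ _ I p f). Qed.

Lemma monomial_ideal_mpolyX (hI : monomial_ideal I) (f : S) m0 m :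
  f \in I -> m0 \in msupp f -> (m0 <= m)%MM -> 'X_[m] \in I.
Proof.
case: hI => X IX /IX[r [c [mm [Xm ->]]]] /msupp_sum_le/flattenP[s /mapP[k _ ->]].
move=> /msuppM_lepm[m1]; rewrite msuppX inE => /eqP-> m10 m0m.
apply/IX; exists 1%N, (fun=> 'X_[m - mm k]), (fun=> mm k); split=> //.
by rewrite big_ord1 -mpolyXD submK // (lepm_trans m10).
Qed.

(** [monomial_ideal] allows infinitely many monomials; finiteness is drawn from the ranks of F_0 and
    F_1. If u lifts the class of 1 and f lies in I, then f u is a boundary, which writes f as a
    combination of [e] and the [w k]. *)
Lemma resolution_generators (F : min_graded_resolution I) :
  exists2 fs : seq S, (forall g, g \in fs -> g \in I) &
    forall f, f \in I -> forall m, m \in msupp f ->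
      exists2 g, g \in fs & exists2 m', m' \in msupp g & (m' <= m)%MM.
Proof.
have [aug_surj aug_ker _] := mgr_exact F.
have [c augc] : exists c : 'I_(mgr_rank F 0) -> S^o,
    forall k, lquot_pi I (c k) = mgr_aug F (delta_mx 0 k).
  apply: (@fin_all_exists 'I_(mgr_rank F 0) (fun=> S^o)
    (fun k v => lquot_pi I v = mgr_aug F (delta_mx 0 k))) => k.
  exact: lquot_pi_surj.
have augE x : mgr_aug F x = lquot_pi I (rowcomb c x).
  rewrite rowcombE [RHS]linear_sum; apply: eq_bigr => k _.
  by rewrite [RHS]linearZ -augc.
have [u uE] := aug_surj (lquot_pi I (1 : S^o)).
pose e : S^o := 1 - rowcomb c u.
have eI : e \in I by apply/lquot_piP; rewrite -uE augE.
pose w k : S^o := rowcomb c (mgr_diff F 0 (delta_mx 0 k)).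
exists ((e : S) :: [seq (w k : S) | k : 'I_(mgr_rank F 1)]).
  move=> g; rewrite inE => /orP[/eqP->//|/mapP[k _ ->]].
  by apply/lquot_pi_eq0; rewrite -augE; apply/aug_ker; eexists.
move=> f fI m.
have [y dy] : exists y, mgr_diff F 0 y = f *: u.
  apply/aug_ker; rewrite linearZ /= uE -[LHS]linearZ; apply/lquot_pi_eq0.
  by rewrite [_ *: _]mulr1.
have -> : f = f * e + \sum_k y 0 k * w k.
  rewrite mulrBr mulr1 -[LHS](subrK (f * rowcomb c u)); congr (_ + _).
  rewrite -[LHS]/(f *: rowcomb c u) -linearZ /= -dy [mgr_diff F 0 y]rowcombE.
  by rewrite linear_sum; apply: eq_bigr => k _; rewrite linearZ.
move=> /msuppD_le; rewrite mem_cat => /orP[/msuppM_lepm[m' m'e m'm]|].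
  by exists e; rewrite ?mem_head //; exists m'.
move=> /msupp_sum_le/flattenP[s /mapP[k _ ->]] /msuppM_lepm[m' m'w m'm].
by exists (w k); [rewrite inE map_f ?orbT ?mem_enum | exists m'].
Qed.

(** The generators are all monomials occurring in the finite list above; each lies in I because I is
    monomial. *)
Lemma monomial_generators (F : min_graded_resolution I) : monomial_ideal I ->
  exists (G : finType) (gen : G -> 'X_{1..n}), forall f : S,
    f \in I <-> forall m, m \in msupp f -> exists g, (gen g <= m)%MM.
Proof.
move=> hI; have [fs fsI fsP] := resolution_generators F.
pose ms := flatten [seq msupp f | f <- fs].
exists (seq_sub ms), (@ssval _ ms) => f; split=> [fI m mf|mfP].
  have [g gfs [m' m'g m'm]] := fsP f fI m mf.
  have m'ms : m' \in ms by apply/flattenP; exists (msupp g); rewrite ?map_f.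
  by exists (SeqSub m'ms).
rewrite [f]mpolyE big_seq; apply: rpred_sum => m /mfP[[m' /= m'ms] m'm].
have /flattenP[s /mapP[g gfs ->] m'g] := m'ms.
rewrite -mul_mpolyC; apply: ideal_mulr.
exact: monomial_ideal_mpolyX (fsI g gfs) m'g m'm.
Qed.

Variable F : min_graded_resolution I.

(** If F_j = 0, each basis vector of F_(j+1) is a cycle, hence a boundary, and minimality forbids
    its entry 1. *)
Lemma mgr_rank_leq i j : (i <= j)%N -> mgr_rank F i = 0%N -> mgr_rank F j = 0%N.
Proof.
elim: j => [|j IH]; first by rewrite leqn0 => /eqP->.
rewrite leq_eqVlt ltnS => /orP[/eqP->//|/IH{}IH /IH r0].
have [_ ex0 exS] := mgr_exact F.
apply/eqP; rewrite -leqn0 leqNgt; apply/negP => rS.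
pose k := Ordinal rS.
have : mgr_diff F j (delta_mx 0 k) = 0.
  by apply/rowP => l; have := ltn_ord l; rewrite [X in (_ < X)%N]r0.
move=> /exS[y yk]; have := mgr_minimal y k; rewrite yk mxE !eqxx mcoeff1 eqxx.
by move/eqP; rewrite oner_eq0.
Qed.

(** Were F_i zero, F would be a projective resolution of length at most p - 1. For p = 0 the claim
    fails when S/I = 0. *)
Lemma mgr_rank_gt0 p i : le_projdim (lquot I) p -> (0 < p)%N -> (i <= p)%N ->
  (0 < mgr_rank F i)%N.
Proof.
move=> hp; case: p hp => // p hp _ ip; rewrite lt0n; apply/eqP => r0.
have /hp : projdim_le (lquot I) p; last by rewrite ltnn.
exists (fun j => 'rV[S]_(mgr_rank F j)), (mgr_diff F), (mgr_aug F); split.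
- exact: mgr_exact.
- move=> j A B g f g_surj; have [k|h _ hP] := @rowcomb_lift _ _ _ _ g f (fun _ _ => True).
    by have [y] := g_surj (f (delta_mx 0 k)); exists y.
  by exists h.
- move=> j pj x; apply/rowP => l; have := ltn_ord l.
  by rewrite [X in (_ < X)%N](mgr_rank_leq (leq_trans ip pj)).
Qed.

Lemma max_shift_step c i : monomial_ideal I -> (i <= c)%N -> (0 < mgr_rank F c.+1)%N ->
  (max_shift F c.+1 + i <= max_shift F c + max_shift F i.+1)%N.
Proof.
move=> hI ic rc; have [G [gen IP]] := monomial_generators F hI.
have [|k tk] := @eq_bigmax 'I_(mgr_rank F c.+1) (@mgr_shift _ _ _ F c.+1).
  by rewrite card_ord.
rewrite [max_shift F c.+1]tk; have [a <- na] := shift_cyclic IP k.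
have [b [d [nb nd le_deg]]] := lcm_cyclic_step ic na.
have [kb kbE] := cyclic_shift IP F nb; have [kd kdE] := cyclic_shift IP F nd.
apply: leq_trans le_deg _; rewrite -kbE -kdE.
by apply: leq_add; apply: leq_bigmax.
Qed.

Lemma max_shift_sum a b : monomial_ideal I -> (b <= a.+1)%N ->
  (forall i, (i <= a + b)%N -> 0 < mgr_rank F i)%N ->
  (max_shift F (a + b) + 'C(b, 2) <= max_shift F a + \sum_(1 <= i < b.+1) max_shift F i)%N.
Proof.
move=> hI; elim: b a => [|b IH] a ba rk; first by rewrite big_geq // !addn0.
rewrite ltnS in ba.
have IHa : (max_shift F (a + b.+1) + 'C(b, 2) <=
    max_shift F a.+1 + \sum_(1 <= i < b.+1) max_shift F i)%N.
  rewrite -addSnnS; apply: IH; first by rewrite ltnW // ltnS ltnW.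
  by move=> i; rewrite addSnnS; apply: rk.
have step : (max_shift F a.+1 + b <= max_shift F a + max_shift F b.+1)%N.
  by apply: max_shift_step => //; apply: rk; rewrite addnS ltnS leq_addr.
rewrite big_nat_recr //= binS bin1.
(* [max_shift F a.+1] cancels from both sides. *)
have := leq_add IHa step; rewrite [X in (X <= _)%N]addnCA -!addnA leq_add2l.
by rewrite [(_ + (max_shift F a + _))%N]addnCA.
Qed.

End MonomialIdealGenerators.

Theorem theorem3p4 (K : fieldType) (n : nat)
    (I : submodClosed {mpoly K[n]}^o) (hI : monomial_ideal I)
    (F : min_graded_resolution I) (a b : nat)
    (hb : (1 <= b)%N) (hab : (b - 1 <= a)%N)
    (hpd : le_projdim (lquot I) (a + b)) :
  (max_shift F (a + b))%:Z <=
    (max_shift F a)%:Z + \sum_(1 <= i < b.+1) (max_shift F i)%:Z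
      - (b * (b - 1) %/ 2)%N%:Z.
Proof.
have ab_gt0 : (0 < a + b)%N by rewrite addn_gt0 hb orbT.
rewrite Num.Theory.lerBrDr -(big_morph Posz PoszD (erefl _)) -!PoszD lez_nat.
rewrite subn1 divn2 -bin2; apply: max_shift_sum => //; first by rewrite -add1n -leq_subLR.
by move=> i; apply: mgr_rank_gt0 hpd ab_gt0.
Qed.
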